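(* For any integers $\alpha \ge 1$ and $n\ge 0$, we have \[\mathrm{pod}_{-3}\Big(3^{2\alpha +2}n+\frac{23\times 3^{2\alpha +1}+3}{8}\Big)\equiv 0 \pmod{9}.\]
   Context: $\mathrm{pod}_{-3}(n)$ denotes the number of partition triples of $n$ in which the odd parts in each of the three partitions are distinct. Equivalently, as formal power series, \[\sum_{n=0}^{\infty}\mathrm{pod}_{-3}(n)q^n=\frac{(-q;q^2)_\infty^3}{(q^2;q^2)_\infty^3}=\frac{1}{\psi(-q)^3},\] where $\psi(q)=\sum_{n=0}^{\infty}q^{n(n+1)/2}$ and $(a;q)_\infty=\prod_{k\ge 0}(1-aq^k)$. *)

(* Defs.v *)
From mathcomp Require Import all_boot.

Set Implicit Arguments.
Unset Strict Implicit.
Unset Printing Implicit Defensive.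

Definition is_partition (s : seq nat) : bool := sorted geq s && (0 \notin s).

Definition is_pod_partition (s : seq nat) : bool :=
  is_partition s && uniq [seq x <- s | odd x].

(* Sequences of at most n natural numbers, each at most n: a finite type
   containing every partition of every m <= n (see [partition_bounded]). *)
Definition bounded_parts (n : nat) : finType := n.-bseq 'I_n.+1.

Definition parts (n : nat) (b : bounded_parts n) : seq nat :=
  [seq val i | i <- bseqval b].

Lemma partition_bounded (n : nat) (s : seq nat) :
  is_partition s -> sumn s <= n -> exists b : bounded_parts n, parts b = s.
Proof.
move=> /andP[_ s_gt0] le_n.
have sz : size s <= n.
  apply: leq_trans le_n; elim: s s_gt0 => //= x s IHs.
  rewrite inE negb_or eq_sym -lt0n => /andP[x_gt0 /IHs le_s].
  by rewrite -add1n leq_add.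
have le_x x : x \in s -> x < n.+1.
  rewrite ltnS => xs; apply: leq_trans le_n.
  elim: s {s_gt0 sz} xs => //= y s IHs.
  rewrite inE => /predU1P[->|/IHs le_s]; first exact: leq_addr.
  exact: leq_trans le_s (leq_addl _ _).
have sz' : size [seq inord x : 'I_n.+1 | x <- s] <= n by rewrite size_map.
exists (Bseq sz'); rewrite /parts /= -map_comp -[RHS]map_id.
by apply/eq_in_map => x /le_x ltx /=; rewrite inordK.
Qed.

(* The empty partition is allowed as a component of a triple. *)
Definition podm3 (n : nat) : nat :=
  #|[set t : {ffun 'I_3 -> bounded_parts n} |
      [forall i, is_pod_partition (parts (t i))] &&
      (\sum_(i < 3) sumn (parts (t i)) == n)]|.

(* Main.v *)
(** Work with formal power series, F(q) = sum (-1)^n pod_{-3}(n) q^n = psi(q)^-3,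
    and let U_r extract the coefficients of index 3n+r.  Since f(q)^9 = f(q^3)^3
    modulo 9, F = psi(q)^6 / psi(q^3)^3 modulo 9.  The dissection
    psi(q) = A(q^3) + q psi(q^9) and the exact identity
    A(q)^3 + q psi(q^3)^3 = psi(q)^4 / psi(q^3) give, modulo 9,
    U_0 F = psi(q)^5 / psi(q^3)^2 and then U_2 U_0 F = psi(q)^2 psi(q^3) =: B.
    Finally U_2 B = psi(q) psi(q^3)^2 is annihilated by U_2 and is mapped back to
    B by U_1, so B(9n+8) = 0 and B(9n+5) = B(n).

    The exact identity says that the norm of psi(q) from series in q to series
    in q^3 is psi(q^3)^4 / psi(q^9): by Gauss, psi is a quotient of
    products of factors 1 - q^n, and the norm of such a factor is (1 - q^n)^3 if
    3 divides n, and 1 - q^(3n) otherwise. *)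
Require Import Defs.
From HB Require Import structures.
From mathcomp Require Import all_boot all_algebra.
From mathcomp Require Import boolp.
From mathcomp Require Import ring zify.

Set Implicit Arguments.
Unset Strict Implicit.
Unset Printing Implicit Defensive.

Import GRing.Theory.

(** * The commutative ring of formal power series *)

Definition series (R : Type) : Type := nat -> R.

HB.instance Definition _ (R : Type) := gen_eqMixin (series R).
HB.instance Definition _ (R : Type) := gen_choiceMixin (series R).

Section SeriesRing.
Local Open Scope ring_scope.
Variable R : comNzRingType.
Implicit Types f g h : series R.

Lemma seriesP f g : f =1 g -> f = g.
Proof. by move=> fg; apply: functional_extensionality_dep. Qed.

Definition series_const (a : R) : series R := fun n => if n == 0%N then a else 0.
Definition series_opp f : series R := fun n => - f n.
Definition series_add f g : series R := fun n => f n + g n.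
Definition series_mul f g : series R := fun n => \sum_(i < n.+1) f i * g (n - i)%N.

Fact series_addA : associative series_add.
Proof. by move=> f g h; apply: seriesP => n; apply: addrA. Qed.
Fact series_addC : commutative series_add.
Proof. by move=> f g; apply: seriesP => n; apply: addrC. Qed.
Fact series_add0 : left_id (series_const 0) series_add.
Proof.
by move=> f; apply: seriesP => n; rewrite /series_add /series_const if_same add0r.
Qed.
Fact series_addN : left_inverse (series_const 0) series_opp series_add.
Proof.
by move=> f; apply: seriesP => n; rewrite /series_add /series_const if_same addNr.
Qed.

HB.instance Definition _ :=
  GRing.isZmodule.Build (series R) series_addA series_addC series_add0 series_addN.

(* The ring laws are inherited from polynomials by truncation. *)
Lemma series_mul_poly m f g n :
  (n < m)%N -> series_mul f g n = ((\poly_(i < m) f i) * (\poly_(i < m) g i))`_n.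
Proof.
move=> ltnm; rewrite coefM; apply: eq_bigr => i _; rewrite !coef_poly.
have := ltn_ord i; rewrite ltnS => lein.
by rewrite (leq_ltn_trans lein ltnm) (leq_ltn_trans (leq_subr i n) ltnm).
Qed.

Fact series_mulC : commutative series_mul.
Proof.
move=> f g; apply: seriesP => n.
by rewrite !(series_mul_poly _ _ (ltnSn n)) mulrC.
Qed.

Fact series_mulA : associative series_mul.
Proof.
move=> f g h; apply: seriesP => n.
pose P u : {poly R} := \poly_(i < n.+1) u i.
have -> : series_mul f (series_mul g h) n = (P f * (P g * P h))`_n.
  rewrite coefM; apply: eq_bigr => i _; have lti := ltn_ord i.
  rewrite (@series_mul_poly n.+1) ?ltnS ?leq_subr //.
  by rewrite [(P f)`_i]coef_poly lti.
have -> : series_mul (series_mul f g) h n = (P f * P g * P h)`_n.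
  rewrite coefM; apply: eq_bigr => i _; have lti := ltn_ord i.
  rewrite (@series_mul_poly n.+1) //.
  by rewrite [(P h)`_(n - i)]coef_poly ltnS leq_subr.
by rewrite mulrA.
Qed.

Fact series_mul1 : left_id (series_const 1) series_mul.
Proof.
move=> f; apply: seriesP => n.
rewrite /series_mul big_ord_recl /= mul1r subn0 big1 ?addr0 // => i _.
by rewrite /series_const /= mul0r.
Qed.

Fact series_mulDl : left_distributive series_mul series_add.
Proof.
move=> f g h; apply: seriesP => n; rewrite /series_add /series_mul -big_split /=.
by apply: eq_bigr => i _; rewrite mulrDl.
Qed.

Fact series_one_neq0 : series_const 1 != 0.
Proof.
apply/eqP => /(congr1 (fun f : series R => f 0%N)); apply/eqP; exact: oner_neq0.
Qed.

HB.instance Definition _ := GRing.Zmodule_isComNzRing.Build (series R)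
  series_mulA series_mulC series_mul1 series_mulDl series_one_neq0.

Lemma series0E n : (0 : series R) n = 0.
Proof. by rewrite /GRing.zero /= /series_const if_same. Qed.

Lemma series1E n : (1 : series R) n = (n == 0%N)%:R.
Proof. by rewrite /GRing.one /= /series_const; case: eqP. Qed.

Lemma seriesDE f g n : (f + g) n = f n + g n.
Proof. by []. Qed.

Lemma seriesNE f n : (- f) n = - f n.
Proof. by []. Qed.

Lemma seriesBE f g n : (f - g) n = f n - g n.
Proof. by []. Qed.

Lemma seriesME f g n : (f * g) n = \sum_(i < n.+1) f i * g (n - i)%N.
Proof. by []. Qed.

Lemma series_sumE (I : Type) (r : seq I) (P : pred I) (F : I -> series R) n :
  (\sum_(i <- r | P i) F i) n = \sum_(i <- r | P i) F i n.
Proof.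
by elim/big_rec2: _ => [|i y1 y2 _ <-]; rewrite ?series0E ?seriesDE.
Qed.

Lemma seriesMnE f k n : (f *+ k) n = f n *+ k.
Proof. by elim: k => [|k IH]; rewrite ?mulr0n ?series0E // !mulrS seriesDE IH. Qed.

Definition seriesX : series R := fun n => (n == 1%N)%:R.
Local Notation X := seriesX.

Lemma seriesXM f n : (X * f) n = if n is m.+1 then f m else 0.
Proof.
rewrite seriesME; case: n => [|n].
  by rewrite big_ord_recl big_ord0 /= mul0r addr0.
rewrite !big_ord_recl /= mul0r add0r /bump /= mul1r subSS subn0.
by rewrite big1 ?addr0 // => i _; rewrite /X /= mul0r.
Qed.

Lemma seriesXnM f k n : (X ^+ k * f) n = if (k <= n)%N then f (n - k)%N else 0.
Proof.
elim: k n => [|k IH] n; first by rewrite mul1r subn0.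
by rewrite exprS -mulrA seriesXM; case: n.
Qed.

Lemma seriesXnE k n : (X ^+ k) n = (n == k)%:R.
Proof.
rewrite -[X ^+ k]mulr1 seriesXnM series1E subn_eq0.
by case: ltngtP.
Qed.

Lemma seriesNXn k n : ((- X) ^+ k) n = (-1) ^+ k * (n == k)%:R.
Proof.
elim: k n => [|k IH] n; first by rewrite !expr0 mul1r series1E.
rewrite exprS mulNr seriesNE seriesXM exprS mulN1r mulNr.
by case: n => [|n]; rewrite ?mulr0 // IH.
Qed.

Lemma series0M f g : (f * g) 0%N = f 0%N * g 0%N.
Proof. by rewrite seriesME big_ord_recl big_ord0 addr0. Qed.

(** This stands in for division: over any coefficient ring, the leading 1 of [f] determines the
    coefficients of the other factor one after another. *)
Lemma series_cancel f g h : f 0%N = 1 -> f * g = f * h -> g = h.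
Proof.
move=> f0 eq_fg; apply: seriesP => n; elim/ltn_ind: n => n IH.
have := congr1 (fun u : series R => u n) eq_fg; rewrite /= !seriesME.
rewrite !big_ord_recl /= subn0 f0 !mul1r => /eqP.
rewrite (eq_bigr (fun i : 'I_n => f (bump 0 i) * h (n - bump 0 i)%N)) => [|i _].
  by rewrite (inj_eq (addIr _)) => /eqP.
by rewrite IH // /bump; have := ltn_ord i; lia.
Qed.

(** * Congruence modulo powers of q *)

Definition series_eqmod m f g := forall n, (n < m)%N -> f n = g n.
Local Notation "f =_( m ) g" := (series_eqmod m f g) (at level 70, m at level 5).

(** Passage to the limit: identities between infinite products are proved on finite truncations. *)
Lemma series_eqmodP f g : (forall m, f =_(m) g) -> f = g.
Proof. by move=> fg; apply: seriesP => n; apply: (fg n.+1). Qed.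

Lemma series_eqmod_sym m f g : f =_(m) g -> g =_(m) f.
Proof. by move=> fg n /fg. Qed.

Lemma series_eqmod_trans m g f h : f =_(m) g -> g =_(m) h -> f =_(m) h.
Proof. by move=> fg gh n ltn; rewrite fg ?gh. Qed.

Lemma series_eqmodW m k f g : (k <= m)%N -> f =_(m) g -> f =_(k) g.
Proof. by move=> lekm fg n ltn; apply/fg/(leq_trans ltn). Qed.

Lemma series_eqmodD m f f' g g' : f =_(m) f' -> g =_(m) g' -> f + g =_(m) f' + g'.
Proof. by move=> ff gg n ltn; rewrite !seriesDE ff ?gg. Qed.

Lemma series_eqmodN m f f' : f =_(m) f' -> - f =_(m) - f'.
Proof. by move=> ff n ltn; rewrite !seriesNE ff. Qed.

Lemma series_eqmodM m f f' g g' : f =_(m) f' -> g =_(m) g' -> f * g =_(m) f' * g'.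
Proof.
move=> ff gg n ltn; rewrite !seriesME; apply: eq_bigr => i _.
by rewrite ff ?gg //; have := ltn_ord i; lia.
Qed.

Lemma series_eqmodX m k f f' : f =_(m) f' -> f ^+ k =_(m) f' ^+ k.
Proof. by move=> ff; elim: k => [//|k IH]; rewrite !exprS; apply: series_eqmodM. Qed.

Lemma series_eqmod_Xn m k f : (m <= k)%N -> X ^+ k * f =_(m) 0.
Proof. by move=> lemk n ltn; rewrite seriesXnM series0E leqNgt (leq_trans ltn lemk). Qed.

(** * Trisection ([sect r] is U_r, [dil] substitutes q^3 for q) and the cubic norm *)

Definition sect r f : series R := fun n => f (3 * n + r)%N.

Definition dil f : series R := fun n => if (3 %| n)%N then f (n %/ 3)%N else 0.

Lemma dil3E f n : dil f (3 * n)%N = f n.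
Proof. by rewrite /dil dvdn_mulr // mulKn. Qed.

Lemma dil3SE f n : dil f (3 * n).+1 = 0.
Proof. by rewrite /dil; case: ifP => //; lia. Qed.

Lemma dil3SSE f n : dil f (3 * n).+2 = 0.
Proof. by rewrite /dil; case: ifP => //; lia. Qed.

Lemma mod3P n : exists k, [\/ n = (3 * k)%N, n = (3 * k).+1 | n = (3 * k).+2].
Proof.
exists (n %/ 3)%N.
have : [|| n %% 3 == 0, n %% 3 == 1 | n %% 3 == 2]%N by lia.
by case/or3P => h; [apply: Or31 | apply: Or32 | apply: Or33]; lia.
Qed.

(** Series in q^3 are scalars for U_r: in the convolution at index 3n + r, [dil f] lives on
    multiples of 3, so [g] is only read at indices congruent to r. *)
Lemma sect_dilM r f g : (r < 3)%N -> sect r (dil f * g) = f * sect r g.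
Proof.
move=> ltr3; apply: seriesP => n.
rewrite -[LHS]/((dil f * g) (3 * n + r)%N) mulrC [f * _]mulrC !seriesME.
pose F i := g i * dil f (3 * n + r - i)%N.
pose G k := \sum_(i < k) g (3 * i + r)%N * f (n - i)%N.
rewrite -[LHS]/(\sum_(i < (3 * n + r).+1) F i) -[RHS]/(G n.+1).
(* In each block of three consecutive indices only the one congruent to r contributes. *)
have F1 k i : (i < 3)%N -> (k <= n)%N -> (3 * k + i <= 3 * n + r)%N ->
    F (3 * k + i)%N = if i == r then g (3 * k + r)%N * f (n - k)%N else 0.
  move=> lti lek le; rewrite /F; case: eqP => [->|/eqP neq].
    by rewrite subnDr -mulnBr dil3E.
  have [j [e|e|e]] := mod3P (3 * n + r - (3 * k + i)).
  - by move/eqP: neq; lia.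
  - by rewrite e dil3SE mulr0.
  - by rewrite e dil3SSE mulr0.
have F10 k : F (3 * k)%N = F (3 * k + 0)%N by rewrite addn0.
have F11 k : F (3 * k).+1 = F (3 * k + 1)%N by rewrite addn1.
have F12 k : F (3 * k).+2 = F (3 * k + 2)%N by rewrite addn2.
have FG k : (k <= n)%N -> \sum_(i < 3 * k) F i = G k.
  elim: k => [|k IH] lek; first by rewrite muln0 /G !big_ord0.
  have -> : (3 * k.+1 = (3 * k).+3)%N by lia.
  rewrite !big_ord_recr /= IH; last by lia.
  rewrite /G big_ord_recr /= -addrA -addrA; congr (_ + _).
  rewrite F10 F11 F12 !F1 //; try lia.
  move: (g _ * _) => u; clear -ltr3.
  by case: r ltr3 => [|[|[|]]] //= _; rewrite ?addr0 ?add0r.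
have -> : G n.+1 = G n + g (3 * n + r)%N * f (n - n)%N by rewrite /G big_ord_recr.
(* Beyond the n full blocks remain the indices 3n, ..., 3n + r, of which only the last
   contributes. *)
rewrite -(FG n) //; clear FG G; clearbody F.
case: r ltr3 F1 => [|[|[|]]] //= _ F1.
- by rewrite addn0 big_ord_recr /= F10 F1 // addn0.
- rewrite addn1 !big_ord_recr /= F10 F11 !F1 ?addr0 ?addn1 //; lia.
- rewrite addn2 !big_ord_recr /= F10 F11 F12 !F1 ?addr0 ?addn2 //; lia.
Qed.

Fact dil_is_zmod_morphism : zmod_morphism dil.
Proof.
move=> f g; apply: seriesP => n; rewrite seriesBE /dil.
by case: ifP => _; rewrite ?subr0.
Qed.

Fact sect_is_zmod_morphism r : zmod_morphism (sect r).
Proof. by []. Qed.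

HB.instance Definition _ :=
  GRing.isZmodMorphism.Build (series R) (series R) dil dil_is_zmod_morphism.
HB.instance Definition _ r :=
  GRing.isZmodMorphism.Build (series R) (series R) (sect r) (sect_is_zmod_morphism r).

Lemma sect0_dil f : sect 0 (dil f) = f.
Proof. by apply: seriesP => n; rewrite /sect addn0 dil3E. Qed.

Lemma sect1_dil f : sect 1 (dil f) = 0.
Proof. by apply: seriesP => n; rewrite /sect addn1 dil3SE series0E. Qed.

Lemma sect2_dil f : sect 2 (dil f) = 0.
Proof. by apply: seriesP => n; rewrite /sect addn2 dil3SSE series0E. Qed.

Lemma sect_inj f g :
  sect 0 f = sect 0 g -> sect 1 f = sect 1 g -> sect 2 f = sect 2 g -> f = g.
Proof.
move=> e0 e1 e2; apply: seriesP => n; have [k [->|->|->]] := mod3P n.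
- by have := congr1 (fun u : series R => u k) e0; rewrite /sect addn0.
- by have := congr1 (fun u : series R => u k) e1; rewrite /sect addn1.
- by have := congr1 (fun u : series R => u k) e2; rewrite /sect addn2.
Qed.

Fact dil_is_monoid_morphism : monoid_morphism dil.
Proof.
split=> [|f g].
  apply: seriesP => n; rewrite /dil !series1E.
  case: ifP => [/dvdnP[k ->]|]; first by rewrite mulnK // muln_eq0 orbF.
  by case: n.
apply: sect_inj.
- by rewrite sect_dilM // !sect0_dil.
- by rewrite sect_dilM // !sect1_dil mulr0.
- by rewrite sect_dilM // !sect2_dil mulr0.
Qed.

HB.instance Definition _ :=
  GRing.isMonoidMorphism.Build (series R) (series R) dil dil_is_monoid_morphism.

Lemma dilX : dil X = X ^+ 3.
Proof.
apply: seriesP => n; rewrite seriesXnE /dil /X.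
case: ifP => [/dvdnP[k ->]|]; first by rewrite mulnK // -[3%N in RHS]mul1n eqn_pmul2r.
by case: eqP => // ->.
Qed.

Lemma dilXn n : dil (X ^+ n) = X ^+ (3 * n).
Proof. by rewrite rmorphXn /= dilX exprM. Qed.

(** Each [X ^+ k] with k < 3 has a single nonzero section. This is how sections are read off from
    explicit expansions below. *)
Lemma sect_dissection a b c :
  [/\ sect 0 (dil a + X * dil b + X ^+ 2 * dil c) = a,
      sect 1 (dil a + X * dil b + X ^+ 2 * dil c) = b
    & sect 2 (dil a + X * dil b + X ^+ 2 * dil c) = c].
Proof.
have sX r k : (r < 3)%N -> (k < 3)%N -> sect r (X ^+ k) = (r == k)%:R.
  move=> ltr ltk; apply: seriesP => n; rewrite /sect seriesXnE.
  case: (eqVneq r k) => [->|neq]; last first.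
    by rewrite mulr0n series0E; case: eqP => //; move/eqP: neq; lia.
  by rewrite mulr1n series1E; congr (_%:R); lia.
rewrite -[dil a]mulr1 -{1 3 5}[X]expr1 ![X ^+ _ * _]mulrC.
by split; rewrite !raddfD /= !sect_dilM // !sX
  -?[1]/(X ^+ 0) ?sX //= ?mulr1 ?mulr0 ?addr0 ?add0r.
Qed.

Lemma dissection f :
  f = dil (sect 0 f) + X * dil (sect 1 f) + X ^+ 2 * dil (sect 2 f).
Proof.
have [e0 e1 e2] := sect_dissection (sect 0 f) (sect 1 f) (sect 2 f).
by apply: sect_inj.
Qed.

(* [norm3 f] is the product of f(w q) over the cube roots of unity w, written
   as a series in q^3: a circulant determinant in the sections of [f]. *)
Definition norm3 f : series R :=
  sect 0 f ^+ 3 + X * sect 1 f ^+ 3 + X ^+ 2 * sect 2 f ^+ 3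
  - X * (sect 0 f * sect 1 f * sect 2 f) *+ 3.

Lemma norm3E a b c :
  norm3 (dil a + X * dil b + X ^+ 2 * dil c) =
  a ^+ 3 + X * b ^+ 3 + X ^+ 2 * c ^+ 3 - X * (a * b * c) *+ 3.
Proof. by rewrite /norm3; have [-> -> ->] := sect_dissection a b c. Qed.

(** The norm is the determinant of multiplication by the series, over series in q^3. Once the
    components of the product are explicit, this is a polynomial identity. *)
Lemma norm3M f g : norm3 (f * g) = norm3 f * norm3 g.
Proof.
rewrite (dissection f) (dissection g).
set a := sect 0 f; set b := sect 1 f; set c := sect 2 f.
set a' := sect 0 g; set b' := sect 1 g; set c' := sect 2 g.
have -> : (dil a + X * dil b + X ^+ 2 * dil c) *
          (dil a' + X * dil b' + X ^+ 2 * dil c') =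
    dil (a * a' + X * (b * c' + c * b')) +
    X * dil (a * b' + b * a' + X * (c * c')) +
    X ^+ 2 * dil (a * c' + b * b' + c * a').
  by rewrite !(rmorphD, rmorphM) /= dilX; ring.
by rewrite !norm3E; ring.
Qed.

Lemma norm3_dil f : norm3 (dil f) = f ^+ 3.
Proof. by rewrite /norm3 sect0_dil sect1_dil sect2_dil; ring. Qed.

Lemma norm3_1 : norm3 1 = 1.
Proof. by have := norm3_dil 1; rewrite rmorph1 expr1n. Qed.

(** When 3 does not divide n, w^n runs with w over all cube roots of unity, so the product of the 1
    - w^n q^n is 1 - q^(3n). *)
Lemma norm3_1subXn n : ~~ (3 %| n)%N -> norm3 (1 - X ^+ n) = 1 - X ^+ n.
Proof.
have [k [->|->|->]] := mod3P n; first by rewrite dvdn_mulr //.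
- move=> _; have e : 1 - X ^+ (3 * k).+1 = dil 1 + X * dil (- X ^+ k) + X ^+ 2 * dil 0.
    by rewrite rmorph1 raddf0 raddfN /= dilXn exprS; ring.
  by rewrite [in LHS]e norm3E (exprS _ (3 * k)) mulnC exprM; ring.
- move=> _; have e : 1 - X ^+ (3 * k).+2 = dil 1 + X * dil 0 + X ^+ 2 * dil (- X ^+ k).
    by rewrite rmorph1 raddf0 raddfN /= dilXn -[(3 * k).+2]addn2 exprD; ring.
  by rewrite [in LHS]e norm3E -[(3 * k).+2]addn2 exprD mulnC exprM; ring.
Qed.

(** Coefficient n of section r is coefficient 3n + r, hence the loss of a factor 3 in precision. *)
Lemma series_eqmod_norm3 m f g : f =_(3 * m) g -> norm3 f =_(m) norm3 g.
Proof.
move=> fg; have sfg r : (r < 3)%N -> sect r f =_(m) sect r g.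
  by move=> ltr3 n ltn; apply: fg; lia.
rewrite /norm3 -[X * (_ * _ * _) *+ 3]mulr_natr -[X * (sect 0 g * _ * _) *+ 3]mulr_natr.
by do ?[apply: series_eqmodD | apply: series_eqmodN | apply: series_eqmodX
  | apply: series_eqmodM | exact: sfg | by []].
Qed.

Lemma series_eqmod_dil m f g : f =_(m) g -> dil f =_(m) dil g.
Proof.
move=> fg n ltn; rewrite /dil; case: ifP => // _; apply: fg.
exact: leq_ltn_trans (leq_div n 3) ltn.
Qed.
End SeriesRing.

(** * Triangular numbers *)

Definition tri k := 'C(k.+1, 2).

Lemma triS k : tri k.+1 = tri k + k.+1.
Proof. by rewrite /tri binS bin1 addnC. Qed.

Lemma tri_double k : 2 * tri k = k * k.+1.
Proof. by elim: k => // k IH; rewrite triS mulnDr IH; lia. Qed.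

Lemma tri_ge k : k <= tri k.
Proof. by elim: k => // k IH; rewrite triS; lia. Qed.

Lemma tri_inj : injective tri.
Proof.
move=> j k e; have := tri_double j; have := tri_double k; rewrite e => -> e2.
by case: (ltngtP j k) => // lt; nia.
Qed.

(** The search may stop at n because [tri k] is at least k. *)
Definition is_tri n := n \in [seq tri k | k <- iota 0 n.+1].

Lemma is_triP n : reflect (exists k, n = tri k) (is_tri n).
Proof.
apply: (iffP mapP) => [[k _ ->]|[k ->]]; first by exists k.
by exists k; rewrite // mem_iota add0n ltnS tri_ge.
Qed.

(* Since 8 tri k + 1 = (2k+1)^2, tri k is never 2 modulo 3, and it is 1 modulo 3
   exactly when 3 divides 2k+1. *)
Lemma is_tri_mod3 n :
  (is_tri (3 * n).+1 = (3 %| n) && is_tri (n %/ 3)) * (is_tri (3 * n).+2 = false).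
Proof.
split; last first.
  apply/negP => /is_triP[k e]; have := tri_double k; rewrite -e.
  by have [j [->|->|->]] := mod3P k; lia.
apply/is_triP/andP => [[k e]|[d /is_triP[k e]]].
  have := tri_double k; rewrite -e; have [j [->|->|->]] := mod3P k => e2; try lia.
  have := tri_double j => e3; have en : n = 3 * tri j by lia.
  by rewrite en dvdn_mulr // mulKn //; split=> //; apply/is_triP; exists j.
exists (3 * k).+1; have := tri_double k; have := tri_double (3 * k).+1.
by rewrite -e; lia.
Qed.

(* Shanks' finite form of Gauss's product for psi: after division by the
   product of the 1 - x^(2j+1), all terms s > 0 on the right are O(x^(2n+1)). *)
Section Shanks.
Local Open Scope ring_scope.
Variables (R : comNzRingType) (x : R).

Definition odd_prod m : R := \prod_(j < m) (1 - x ^+ (2 * j).+1).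

Definition shanks_term m s : R :=
  odd_prod s * \prod_(s <= j < m) (1 - x ^+ (2 * j).+2).

(** The summand is the s-th Shanks term for m + 1 minus (1 - x^(2m+1)) times the one for m. It is
    also the difference of the right-hand side at s + 1 and at s, whose value at 0 vanishes because
    1 - x^0 = 0. *)
Lemma shanks_telescope m k : (k <= m)%N ->
  \sum_(s < k) shanks_term m s * x ^+ (s * (2 * m).+1) *
     ((1 - x ^+ (2 * m).+2) * x ^+ (2 * s) - (1 - x ^+ (2 * m).+1)) =
  shanks_term m k * (1 - x ^+ (2 * k)) * x ^+ (k * (2 * m).+1).
Proof.
elim: k => [|k IH] lekm; first by rewrite big_ord0 muln0 subrr mulr0 mul0r.
rewrite big_ord_recr /= IH 1?ltnW // /shanks_term (big_ltn lekm).
rewrite /odd_prod big_ord_recr /=; move: (\prod_(i < k) _) (\prod_(_ <= i < _) _) => u v.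
have -> : (2 * k.+1 = (2 * k).+2)%N by lia.
have -> : (k.+1 * (2 * m).+1 = (2 * m).+1 + k * (2 * m).+1)%N by lia.
rewrite exprD !exprS; move: (x ^+ (2 * k)) (x ^+ (2 * m)) (x ^+ (k * _)) => a b c.
by ring.
Qed.

Lemma shanks_identity n :
  odd_prod n * \sum_(k < 2 * n) x ^+ tri k =
  \sum_(s < n) shanks_term n s * x ^+ (s * (2 * n).+1).
Proof.
elim: n => [|m IH]; first by rewrite muln0 !big_ord0 mulr0.
have -> : (2 * m.+1 = (2 * m).+2)%N by lia.
rewrite !big_ord_recr /= {1}/odd_prod big_ord_recr /= -/(odd_prod m).
have -> : odd_prod m * (1 - x ^+ (2 * m).+1) *
    (\sum_(i < 2 * m) x ^+ tri i + x ^+ tri (2 * m) + x ^+ tri (2 * m).+1) =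
  (1 - x ^+ (2 * m).+1) * (odd_prod m * \sum_(i < 2 * m) x ^+ tri i) +
  odd_prod m * (1 - x ^+ (2 * m).+1) * (x ^+ tri (2 * m) + x ^+ tri (2 * m).+1).
  by ring.
rewrite IH.
have step (s : 'I_m) : shanks_term m.+1 s * x ^+ (s * (2 * m).+3) =
    shanks_term m s * x ^+ (s * (2 * m).+1) *
      ((1 - x ^+ (2 * m).+2) * x ^+ (2 * s) - (1 - x ^+ (2 * m).+1)) +
    (1 - x ^+ (2 * m).+1) * (shanks_term m s * x ^+ (s * (2 * m).+1)).
  have lts := ltn_ord s; rewrite /shanks_term big_nat_recr 1?ltnW //=.
  have -> : (s * (2 * m).+3 = 2 * s + s * (2 * m).+1)%N by lia.
  by rewrite exprD; ring.
rewrite (eq_bigr _ (fun s _ => step s)) big_split /= -mulr_sumr shanks_telescope //.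
rewrite /shanks_term big_geq // big_nat1 mulr1.
(* With the remaining exponents written as m (2m + 1) plus a term linear in m, only a ring identity
   is left. *)
have -> : tri (2 * m) = (m * (2 * m).+1)%N by have := tri_double (2 * m); lia.
have -> : tri (2 * m).+1 = (m * (2 * m).+1 + (2 * m).+1)%N.
  by have := tri_double (2 * m).+1; lia.
have -> : (m * (2 * m).+3 = 2 * m + m * (2 * m).+1)%N by lia.
move E: (2 * m)%N => u; move: (m * u.+1)%N => w; rewrite !exprD !exprS.
by ring.
Qed.

End Shanks.

(** * Euler products, Gauss's formula and the norm of [psi] *)

Section Theta.
Local Open Scope ring_scope.
Variable R : comNzRingType.
Implicit Types (f g : series R) (S : pred nat).
Local Notation X := (@seriesX R).
Local Notation "f =_( m ) g" := (series_eqmod m f g) (at level 70, m at level 5).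

Definition eprod_part S m : series R :=
  \prod_(i < m) (if S i.+1 then 1 - X ^+ i.+1 else 1).

(** The coefficient of q^n can be taken from the n-th partial product, since factors 1 - q^i with i
    > n no longer affect it. *)
Definition eprod S : series R := fun n => eprod_part S n n.

Lemma eprod_partS S m :
  eprod_part S m.+1 = eprod_part S m * (if S m.+1 then 1 - X ^+ m.+1 else 1).
Proof. by rewrite /eprod_part big_ord_recr. Qed.

Lemma eprod_part_eqmod S m k :
  (m <= k)%N -> eprod_part S k =_(m.+1) eprod_part S m.
Proof.
move=> lemk; rewrite -(subnKC lemk); elim: (k - m)%N => [|d IH]; first by rewrite addn0.
apply: series_eqmod_trans IH; rewrite addnS eprod_partS.
case: ifP => // _; last by rewrite mulr1.
rewrite mulrBr mulr1 -[X in _ =_(_) X]subr0; apply: series_eqmodD => //.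
by apply: series_eqmodN; rewrite mulrC; apply: series_eqmod_Xn; lia.
Qed.

Lemma eprod_eqmod S m k : (m <= k)%N -> eprod S =_(m.+1) eprod_part S k.
Proof.
by move=> lemk n ltn; rewrite /eprod (@eprod_part_eqmod S n k) //; lia.
Qed.

Lemma eprod_0 S : eprod S 0%N = 1.
Proof. by rewrite /eprod /eprod_part big_ord0 series1E. Qed.

(** By the invariance of [S], the factors whose index is a multiple of 3 form the whole product in
    q^3. *)
Lemma eprod_prime_to_3 S : (forall i, S (3 * i)%N = S i) ->
  eprod S = eprod [pred i | S i && ~~ (3 %| i)%N] * dil (eprod S).
Proof.
move=> S3; set S' := [pred i | _].
have split3 k : eprod_part S (3 * k)%N = eprod_part S' (3 * k)%N * dil (eprod_part S k).
  elim: k => [|k IH]; first by rewrite /eprod_part muln0 !big_ord0 rmorph1 mulr1.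
  have e3 : (3 * k.+1 = (3 * k).+3)%N by lia.
  rewrite e3 !eprod_partS IH rmorphM /= -!e3 S3 dvdn_mulr // andbF.
  have -> : (3 %| (3 * k).+1)%N = false by lia.
  have -> : (3 %| (3 * k).+2)%N = false by lia.
  rewrite !andbT (fun_if (@dil R)) rmorphB !rmorph1 /= dilXn.
  by move: (if _ then _ else _) (if _ then _ else _) (if _ then _ else _) => a b c; ring.
apply: series_eqmodP => m; apply: (@series_eqmodW _ m.+1) => //.
apply: (@series_eqmod_trans _ _ (eprod_part S (3 * m)%N)).
  by apply: eprod_eqmod; lia.
rewrite split3; apply: series_eqmod_sym; apply: series_eqmodM.
  by apply: eprod_eqmod; lia.
by apply: series_eqmod_dil; apply: eprod_eqmod.
Qed.

(** The norm is multiplicative and fixes every factor. The partial product runs to 3m because the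
    norm divides the precision by 3. *)
Lemma norm3_eprod_id S : (forall i, S i -> ~~ (3 %| i)%N) -> norm3 (eprod S) = eprod S.
Proof.
move=> S3; apply: series_eqmodP => m.
have e : norm3 (eprod_part S (3 * m)%N) = eprod_part S (3 * m)%N.
  rewrite /eprod_part (big_morph _ (@norm3M R) (norm3_1 R)).
  by apply: eq_bigr => i _; case: ifP => [/S3/norm3_1subXn ->|]; rewrite ?norm3_1.
apply: (@series_eqmod_trans _ _ (eprod_part S (3 * m)%N)).
  rewrite -e; apply: series_eqmod_norm3.
  by apply: (@series_eqmodW _ (3 * m).+1) => //; apply: eprod_eqmod.
apply: series_eqmod_sym; apply: (@series_eqmodW _ m.+1) => //.
by apply: eprod_eqmod; lia.
Qed.

(** Write P = P' P(q^3) with P' the product over indices prime to 3. The norm fixes P' and sends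
    P(q^3) to P^3, so P has norm P' P^3; multiplying by P(q^3) gives P^4. *)
Lemma norm3_eprod S : (forall i, S (3 * i)%N = S i) ->
  norm3 (eprod S) * dil (eprod S) = eprod S ^+ 4.
Proof.
move=> S3; set P := eprod S.
have e := eprod_prime_to_3 S3; rewrite -/P in e.
rewrite {1}e norm3M norm3_dil norm3_eprod_id; last by move=> i /andP[].
by rewrite mulrAC -e -exprS.
Qed.

Definition psi : series R := fun n => (is_tri n)%:R.

Lemma psi_eqmod m : psi =_(m) \sum_(k < m) X ^+ tri k.
Proof.
move=> n ltn; rewrite series_sumE /psi.
under eq_bigr do rewrite seriesXnE.
case: is_triP => [[k e]|no]; last first.
  by rewrite big1 // => k _; case: eqP => // e; case: no; exists k.
have ltk : (k < m)%N by apply: leq_ltn_trans ltn; rewrite e tri_ge.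
rewrite (bigD1 (Ordinal ltk)) //= {1}e eqxx big1 ?addr0 // => i nei.
by rewrite e (inj_eq tri_inj) eq_sym; move: nei; rewrite -val_eqE /= => /negbTE ->.
Qed.

(** Gauss's product formula without denominators, from Shanks' identity modulo q^n for every n. *)
Lemma psi_eprod : eprod odd * psi = eprod (predC odd).
Proof.
apply: series_eqmodP => n.
have odd2 m : odd_prod X m = eprod_part odd (2 * m).
  elim: m => [|m IH]; first by rewrite /odd_prod /eprod_part muln0 !big_ord0.
  have -> : (2 * m.+1 = (2 * m).+2)%N by lia.
  by rewrite !eprod_partS -IH /= oddM /= mulr1 /odd_prod big_ord_recr.
have even2 m : \prod_(0 <= j < m) (1 - X ^+ (2 * j).+2) = eprod_part (predC odd) (2 * m).
  elim: m => [|m IH]; first by rewrite big_geq // /eprod_part muln0 big_ord0.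
  have -> : (2 * m.+1 = (2 * m).+2)%N by lia.
  by rewrite !eprod_partS -IH /= oddM /= mulr1 big_nat_recr.
apply: (@series_eqmod_trans _ _ (odd_prod X n * \sum_(k < 2 * n) X ^+ tri k)).
  apply: series_eqmodM.
    by rewrite odd2; apply: (@series_eqmodW _ n.+1) => //; apply: eprod_eqmod; lia.
  by apply: (@series_eqmodW _ (2 * n)); [lia | apply: psi_eqmod].
rewrite shanks_identity; case: n => [|n] //.
(* The term s = 0 is a partial product over even indices; the others carry a power of q beyond the
   precision. *)
rewrite big_ord_recl mul0n expr0 mulr1 -[X in _ =_(_) X]addr0; apply: series_eqmodD.
  rewrite /shanks_term /odd_prod big_ord0 mul1r even2; apply: series_eqmod_sym.
  by apply: (@series_eqmodW _ n.+2) => //; apply: eprod_eqmod; lia.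
move=> i lti; rewrite series_sumE series0E big1 // => s _.
by rewrite mulrC (@series_eqmod_Xn _ n.+1) ?series0E // /= /bump; nia.
Qed.

Lemma norm3_psi : norm3 psi * dil psi = psi ^+ 4.
Proof.
have eO := @norm3_eprod odd (fun i => oddM 3 i).
have eE : norm3 (eprod (predC odd)) * dil (eprod (predC odd)) = eprod (predC odd) ^+ 4.
  by apply: norm3_eprod => i /=; rewrite oddM.
rewrite -psi_eprod norm3M rmorphM /= exprMn -eO in eE.
(* The norm identity for the even product is divided by the one for the odd product; by [eO] the
   divisor is a fourth power with constant term 1. *)
apply: (@series_cancel _ (norm3 (eprod odd) * dil (eprod odd))).
  by rewrite eO !exprS expr0 !series0M eprod_0 series1E !mul1r.
by rewrite -eE; ring.
Qed.

Lemma sect1_psi : sect 1 psi = dil psi.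
Proof.
apply: seriesP => n; rewrite /sect /psi /dil addn1 is_tri_mod3.
by case: ifP.
Qed.

Lemma sect2_psi : sect 2 psi = 0.
Proof. by apply: seriesP => n; rewrite /sect /psi addn2 is_tri_mod3 series0E. Qed.

Lemma psi_dissection : psi = dil (sect 0 psi) + X * dil (dil psi).
Proof. by rewrite {1}[psi]dissection sect1_psi sect2_psi raddf0 mulr0 addr0. Qed.

Lemma norm3_psiE : norm3 psi = sect 0 psi ^+ 3 + X * dil psi ^+ 3.
Proof. by rewrite /norm3 sect1_psi sect2_psi; ring. Qed.

End Theta.

(** * Enumeration of partitions with distinct odd parts *)

Fixpoint pod_list k : nat -> seq (seq nat) :=
  if k is k'.+1 then
    fix pod_list_k n := pod_list k' n ++
      (if n is n'.+1 then
         if k' <= n' then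
           [seq k :: s | s <- if odd k then pod_list k' (n' - k') else pod_list_k (n' - k')]
         else [::]
       else [::])
  else fun n => if n == 0 then [:: [::]] else [::].

Lemma pod_listS k n : pod_list k.+1 n = pod_list k n ++
  if k < n then
    [seq k.+1 :: s | s <- pod_list (if odd k.+1 then k else k.+1) (n - k.+1)]
  else [::].
Proof.
case: n => [|n] //; rewrite ltnS subSS.
by rewrite (fun_if (fun j => pod_list j (n - k))).
Qed.

(** Equal parts of a decreasing sequence are adjacent, so distinctness of the odd parts amounts to a
    strict descent after each odd part. The default [0] of [head] makes the bound harmless for an
    empty tail. *)
Lemma pod_partition_cons x s : is_pod_partition (x :: s) =
  [&& 0 < x, head 0 s <= (if odd x then x.-1 else x) & is_pod_partition s].
Proof.
rewrite /is_pod_partition /is_partition in_cons negb_or eq_sym -lt0n /=.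
case: x => [|x]; first by rewrite andbF.
case: s => [|y s]; first by case: ifP.
rewrite [path _ _ _]/= [sorted _ _]/= [head _ _]/=.
have sub : path geq y s -> all (geq y) s.
  by rewrite (path_sortedE (fun a b c ba cb => leq_trans cb ba)) => /andP[].
case: ifP => odd_x; last by rewrite -!andbA.
rewrite cons_uniq mem_filter odd_x andTb [x.+1 \in _]in_cons eq_sym.
case: (boolP (path geq y s)) => [/sub/allP sy|]; last by rewrite !andbF.
case: (ltngtP y x.+1) => [lt|gt|->]; last 2 first.
- by have /negbTE-> : ~~ (y <= x.+1.-1) by rewrite /=; lia.
- by rewrite /= ltnn !andbF.
have -> : y <= x.+1.-1 by [].
rewrite !andTb orFb; case: (boolP (_ \in s)) => [/sy /=|]; first lia.
by rewrite andTb.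
Qed.

Lemma mem_pod_list k n s :
  (s \in pod_list k n) = [&& is_pod_partition s, head 0 s <= k & sumn s == n].
Proof.
elim: k n s => [|k IH] n s.
  rewrite /= leqn0; case: s => [|[|x] s].
  - by case: n.
  - by rewrite pod_partition_cons; case: n.
  - by rewrite !andbF; case: n.
elim/ltn_ind: n s => n IHn s; rewrite pod_listS mem_cat IH.
case: s => [|x s].
  case: ifP => _; last by rewrite orbF.
  by rewrite orbC; case: (boolP (_ \in map _ _)) => [/mapP[]|].
have memS (l : seq (seq nat)) :
    (x :: s \in [seq k.+1 :: t | t <- l]) = (x == k.+1) && (s \in l).
  apply/mapP/andP => [[t tl [-> ->]]|[/eqP-> sl]]; last by exists s.
  by rewrite eqxx.
have -> : (x :: s \in if k < n then
      [seq k.+1 :: t | t <- pod_list (if odd k.+1 then k else k.+1) (n - k.+1)]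
    else [::]) = [&& x == k.+1, is_pod_partition (x :: s) & sumn (x :: s) == n].
  case: ifP => ltk; last first.
    by rewrite in_nil; case: eqP => //= ->; case: eqP; rewrite ?andbF //; lia.
  rewrite memS; case: eqP => //= ->; rewrite pod_partition_cons /=.
  have e : (k.+1 + sumn s == n) = (sumn s == n - k.+1) by lia.
  rewrite e; case: ifP => odd_k; first by rewrite IH andbCA andbA.
  by rewrite IHn 1?andbCA 1?andbA //; lia.
rewrite /=; case: (is_pod_partition _); rewrite ?andbF //=.
by case: (_ == n); rewrite ?andbF ?andbT // orbC -leq_eqVlt.
Qed.

Lemma pod_list_uniq k n : uniq (pod_list k n).
Proof.
elim: k n => [|k IH] n; first by case: n.
elim/ltn_ind: n => n IHn; rewrite pod_listS cat_uniq IH /=.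
case: ifP => // ltk; apply/andP; split.
  apply/hasP => -[_ /mapP[s _ ->]] /=.
  by rewrite mem_pod_list /= ltnn andbF.
rewrite map_inj_uniq => [|s t [] //].
by case: ifP => _; [exact: IH | apply: IHn; lia].
Qed.

(** After a part [k.+1] is removed, an odd one must not recur, so the bound drops to [k]; an even
    one may recur. *)
Lemma size_pod_listS k n : size (pod_list k.+1 n) = size (pod_list k n) +
  if k < n then size (pod_list (if odd k.+1 then k else k.+1) (n - k.+1)) else 0.
Proof. by rewrite pod_listS size_cat; case: (k < n); rewrite ?size_map. Qed.

Lemma size_pod_list_stable k n : n <= k -> size (pod_list k n) = size (pod_list n n).
Proof.
move=> lenk; rewrite -(subnKC lenk); elim: (k - n) => [|d IH]; first by rewrite addn0.
by rewrite addnS size_pod_listS ltnNge leq_addr addn0.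
Qed.

Lemma parts_inj n : injective (@parts n).
Proof. by move=> a b /(inj_map val_inj) /val_inj. Qed.

(** The bound [n] is kept apart from the size [i] because the components of a triple of total [n]
    all live in [bounded_parts n], with varying sizes. *)
Lemma card_pod_parts n i : i <= n ->
  #|[pred b : bounded_parts n | is_pod_partition (parts b) & sumn (parts b) == i]|
  = size (pod_list i i).
Proof.
move=> lein; rewrite cardE -(size_map (@parts n)); apply: perm_size.
apply: uniq_perm; rewrite ?pod_list_uniq //.
  by rewrite (map_inj_uniq (@parts_inj n)) enum_uniq.
move=> s; rewrite mem_pod_list; apply/mapP/and3P => [[b]|[pod_s _ /eqP sum_s]].
  rewrite mem_enum => /andP[pod_b /eqP sum_b] ->; split; rewrite ?sum_b //.
  rewrite -sum_b; case: (parts b) => //= x t; exact: leq_addr.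
have le_s : sumn s <= n by rewrite sum_s.
have [b eb] := partition_bounded (proj1 (andP pod_s)) le_s.
by exists b; rewrite ?mem_enum // inE eb pod_s sum_s eqxx.
Qed.

(** * The generating functions of pod partitions and of their triples *)

Section PodSeries.
Local Open Scope ring_scope.
Variable R : comNzRingType.
Local Notation X := (@seriesX R).
Local Notation "f =_( m ) g" := (series_eqmod m f g) (at level 70, m at level 5).

(* The signs turn the generating function of the pod partitions into 1/psi(q). *)
Definition pod_series_upto k : series R := fun n => (-1) ^+ n * (size (pod_list k n))%:R.

Definition pod_series : series R := fun n => pod_series_upto n n.

Lemma pod_series_uptoS k : pod_series_upto k.+1 =
  pod_series_upto k + (- X) ^+ k.+1 * pod_series_upto (if odd k.+1 then k else k.+1).
Proof.
apply: seriesP => n; rewrite seriesDE exprNn -mulrA.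
have signM (f : series R) m : ((-1) ^+ m * f : series R) n = (-1) ^+ m * f n.
  elim: m f => [|m IH] f; first by rewrite !mul1r.
  by rewrite exprSr -mulrA IH mulN1r seriesNE exprSr -mulrA mulN1r.
rewrite signM seriesXnM /pod_series_upto size_pod_listS natrD mulrDr; congr (_ + _).
case: ifP => ltk; last by rewrite !mulr0.
by rewrite mulrA -exprD subnKC.
Qed.

(** Allowing an odd part k + 1, at most once and with sign -1, multiplies the series by 1 - q^(k+1);
    allowing an even one, any number of times, divides it by that factor. *)
Lemma pod_series_upto_eprod k :
  pod_series_upto k * eprod_part R (predC odd) k = eprod_part R odd k.
Proof.
elim: k => [|k IH].
  rewrite /eprod_part !big_ord0 mulr1; apply: seriesP => n.
  by rewrite series1E /pod_series_upto; case: n => [|n]; rewrite ?mulr1 ?mulr0.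
rewrite !eprod_partS -IH /=; have := pod_series_uptoS k.
rewrite exprNn -signr_odd /=; case: (odd k) => /= e; rewrite mulr1.
  have eF : pod_series_upto k.+1 * (1 - X ^+ k.+1) = pod_series_upto k.
    by rewrite mulrBr mulr1 {1}e; ring.
  by rewrite mulrA mulrAC eF.
by rewrite e expr1 mulN1r mulNr; ring.
Qed.

Lemma pod_series_eprod : pod_series * eprod R (predC odd) = eprod R odd.
Proof.
apply: series_eqmodP => m.
have le_m := @series_eqmodW R m.+1 m _ _ (leqnSn m).
apply: (@series_eqmod_trans _ _ (eprod_part R odd m)); last first.
  by apply/le_m/series_eqmod_sym/eprod_eqmod.
rewrite -pod_series_upto_eprod; apply: series_eqmodM.
  move=> n ltn; rewrite /pod_series /pod_series_upto.
  by rewrite (@size_pod_list_stable m) // ltnW.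
by apply/le_m/eprod_eqmod.
Qed.

Lemma psi_pod_series : psi R * pod_series = 1.
Proof.
apply: (@series_cancel _ (eprod R odd)); first exact: eprod_0.
by rewrite mulrA psi_eprod mulrC pod_series_eprod mulr1.
Qed.

(** Modulo q^(n+1) the series is a sum over the finite type [bounded_parts n]. Its cube distributes
    into a sum over triples, and each pod triple of total n contributes (-1)^n. *)
Lemma pod_series_cube n : (pod_series ^+ 3) n = (-1) ^+ n * (podm3 n)%:R.
Proof.
pose weight (b : bounded_parts n) : series R :=
  if is_pod_partition (parts b) then (- X) ^+ sumn (parts b) else 0.
have eqG : pod_series =_(n.+1) \sum_b weight b.
  move=> i lti; rewrite series_sumE /pod_series /pod_series_upto -(@card_pod_parts n i) //.
  rewrite -sum1_card natr_sum mulr_sumr big_mkcond /=; apply: eq_bigr => b _.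
  rewrite /weight inE; case: ifP => /=; case: ifP => // _; rewrite ?series0E //.
  - by move/eqP=> <-; rewrite seriesNXn eqxx.
  - by move=> /= ne; rewrite seriesNXn eq_sym ne mulr0.
rewrite (series_eqmodX 3 eqG) //.
have -> : (\sum_b weight b) ^+ 3 = \prod_(i < 3) \sum_b weight b.
  by rewrite prodr_const card_ord.
rewrite (bigA_distr_bigA (fun _ => weight)) series_sumE.
rewrite /podm3 -sum1_card natr_sum mulr_sumr [RHS]big_mkcond /=; apply: eq_bigr => f _.
rewrite inE; case: forallP => [pod_f|npod] /=; last first.
  have [i /negbTE npod_i] : exists i, ~~ is_pod_partition (parts (f i)).
    by apply/existsP; rewrite -negb_forall; apply/negP => /forallP.
  by rewrite (bigD1 i) //= /weight npod_i mul0r series0E.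
rewrite (eq_bigr (fun i => (- X) ^+ sumn (parts (f i)))) => [|i _]; last first.
  by rewrite /weight pod_f.
rewrite -expr_sum seriesNXn eq_sym mulr_natr.
by case: eqP => [->|_]; rewrite ?mulr1.
Qed.

End PodSeries.

(** * Dissections modulo 9 *)

Section Mod9.
Local Open Scope ring_scope.
Implicit Types f g : series 'Z_9.
Local Notation X := (@seriesX 'Z_9).
Local Notation psi := (psi 'Z_9).
Local Notation pod := (pod_series 'Z_9).

(** Fermat's congruence modulo 3; inside ['Z_9], congruence modulo 3 is equality after
    multiplication by 3. *)
Lemma Z9_cube (a : 'Z_9) : (a ^+ 3 - a) *+ 3 = 0.
Proof. by case: a => [[|[|[|[|[|[|[|[|[|]]]]]]]]] //= lta]; apply: val_inj. Qed.

Lemma Z9_mul3_eq0 (a : 'Z_9) : a *+ 3 = 0 -> a = (a %/ 3)%:R *+ 3.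
Proof.
by case: a => [[|[|[|[|[|[|[|[|[|]]]]]]]]] //= lta] /(congr1 val) // _; apply: val_inj.
Qed.

Lemma series_nine f : f *+ 9 = 0.
Proof.
apply: seriesP => n; rewrite seriesMnE series0E -mulr_natr.
have -> : 9%:R = 0 :> 'Z_9 by apply: val_inj.
by rewrite mulr0.
Qed.

(** Frobenius modulo 3. Writing f = a + q g moves the claim from coefficient n of [f] to coefficient
    n - 3 of [g], whence the induction over all series at once. *)
Lemma series_cube f : (f ^+ 3 - dil f) *+ 3 = 0.
Proof.
apply: seriesP => n; rewrite series0E.
elim/ltn_ind: n f => n IH f.
pose a : series 'Z_9 := series_const (f 0%N); pose g : series 'Z_9 := fun n => f n.+1.
have ef : f = a + X * g.
  by apply: seriesP => -[|m]; rewrite seriesDE seriesXM ?addr0 // [a _]/= add0r.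
have a3 : (a ^+ 3 - dil a) *+ 3 = 0.
  have constM b h m : (series_const b * h : series 'Z_9) m = b * h m.
    rewrite seriesME big_ord_recl subn0 big1 ?addr0 // => i _.
    by rewrite /series_const /= mul0r.
  apply: seriesP => m; rewrite seriesMnE seriesBE series0E exprS expr2 !constM.
  rewrite /dil /a /series_const; case: m => [|m]; first exact: Z9_cube.
  rewrite !mulr0 sub0r; case: ifP => d; last by rewrite oppr0 mul0rn.
  by case: eqP => [|_]; [lia | rewrite oppr0 mul0rn].
have -> : (f ^+ 3 - dil f) *+ 3 = X ^+ 3 * ((g ^+ 3 - dil g) *+ 3).
  (* The mixed binomial terms have coefficient 3, which the outer 3 turns into 9. *)
  transitivity ((a ^+ 3 - dil a) *+ 3 + X ^+ 3 * ((g ^+ 3 - dil g) *+ 3)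
      + (a ^+ 2 * (X * g) + a * (X * g) ^+ 2) *+ 9).
    by rewrite ef rmorphD rmorphM /= dilX; ring.
  by rewrite a3 series_nine add0r addr0.
by rewrite seriesXnM; case: ifP => // le3; apply: IH; lia.
Qed.

(** Cubing lifts a congruence modulo 3 to one modulo 9; here f^3 = f(q^3) + 3e is cubed. *)
Lemma series_ninth_power f : f ^+ 9 = dil f ^+ 3.
Proof.
pose d := f ^+ 3 - dil f; pose e : series 'Z_9 := fun n => (d n %/ 3)%:R.
have ed : f ^+ 3 = dil f + e *+ 3.
  rewrite -[LHS](subrK (dil f)) addrC; congr (_ + _); apply: seriesP => n.
  rewrite seriesMnE; apply: Z9_mul3_eq0.
  by rewrite -seriesMnE series_cube series0E.
have -> : f ^+ 9 = (f ^+ 3) ^+ 3 by rewrite -exprM.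
rewrite ed; transitivity (dil f ^+ 3 +
    (dil f ^+ 2 * e + dil f * e ^+ 2 *+ 3 + e ^+ 3 *+ 3) *+ 9); first by ring.
by rewrite series_nine addr0.
Qed.

Lemma dil_psi_pod : dil psi * dil pod = 1.
Proof. by rewrite -rmorphM psi_pod_series rmorph1. Qed.

Lemma norm3_psi_pod : norm3 psi = psi ^+ 4 * dil pod.
Proof. by rewrite -norm3_psi -mulrA dil_psi_pod mulr1. Qed.

Lemma pod_cube_psi : pod ^+ 3 = dil (pod ^+ 3) * psi ^+ 6.
Proof.
(* Multiplying [pod ^+ 3] by the sixth power of [psi * pod], which is 1, gives
   [pod ^+ 9 * psi ^+ 6]. *)
rewrite rmorphXn -series_ninth_power -[LHS]mulr1 -[X in _ * X](expr1n _ 6).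
by rewrite -(psi_pod_series 'Z_9); ring.
Qed.

Local Notation A := (sect 0 psi).

Lemma sect0_pod_cube : sect 0 (pod ^+ 3) = psi ^+ 5 * dil pod ^+ 2.
Proof.
rewrite pod_cube_psi sect_dilM //.
(* The binomial expansion of (A(q^3) + q psi(q^9))^6, sorted by exponents modulo 3. *)
have -> : psi ^+ 6 =
    dil (A ^+ 6 + A ^+ 3 * X * dil psi ^+ 3 *+ 20 + X ^+ 2 * dil psi ^+ 6)
  + X * dil (A ^+ 5 * dil psi *+ 6 + X * A ^+ 2 * dil psi ^+ 4 *+ 15)
  + X ^+ 2 * dil (A ^+ 4 * dil psi ^+ 2 *+ 15 + X * A * dil psi ^+ 5 *+ 6).
  by rewrite {1}[psi]psi_dissection !(rmorphD, rmorphMn, rmorphM, rmorphXn) /= dilX; ring.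
have [-> _ _] := sect_dissection
  (A ^+ 6 + A ^+ 3 * X * dil psi ^+ 3 *+ 20 + X ^+ 2 * dil psi ^+ 6)
  (A ^+ 5 * dil psi *+ 6 + X * A ^+ 2 * dil psi ^+ 4 *+ 15)
  (A ^+ 4 * dil psi ^+ 2 *+ 15 + X * A * dil psi ^+ 5 *+ 6).
(* The middle coefficient is 20 = 2 + 18, so modulo 9 the section is the square of the norm. *)
transitivity (pod ^+ 3 * (norm3 psi ^+ 2 + A ^+ 3 * X * dil psi ^+ 3 *+ 2 *+ 9)).
  by rewrite norm3_psiE; ring.
rewrite series_nine addr0 norm3_psi_pod -[RHS]mul1r -(expr1n _ 3).
by rewrite -(psi_pod_series 'Z_9); ring.
Qed.

Lemma sect2_sect0_pod_cube : sect 2 (sect 0 (pod ^+ 3)) = psi ^+ 2 * dil psi.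
Proof.
rewrite sect0_pod_cube mulrC -rmorphXn sect_dilM //.
have -> : psi ^+ 5 =
    dil (A ^+ 5 + A ^+ 2 * X * dil psi ^+ 3 *+ 10)
  + X * dil (A ^+ 4 * dil psi *+ 5 + X * A * dil psi ^+ 4 *+ 5)
  + X ^+ 2 * dil (dil psi ^+ 2 * (A ^+ 3 *+ 10 + X * dil psi ^+ 3)).
  by rewrite {1}[psi]psi_dissection !(rmorphD, rmorphMn, rmorphM, rmorphXn) /= dilX; ring.
have [_ _ ->] := sect_dissection
  (A ^+ 5 + A ^+ 2 * X * dil psi ^+ 3 *+ 10)
  (A ^+ 4 * dil psi *+ 5 + X * A * dil psi ^+ 4 *+ 5)
  (dil psi ^+ 2 * (A ^+ 3 *+ 10 + X * dil psi ^+ 3)).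
(* Since 10 = 1 + 9, the bracket is the norm modulo 9. *)
transitivity (pod ^+ 2 * dil psi ^+ 2 * (norm3 psi + A ^+ 3 *+ 9)).
  by rewrite norm3_psiE; ring.
rewrite series_nine addr0 norm3_psi_pod.
transitivity ((psi * pod) ^+ 2 * (dil psi * dil pod) * (psi ^+ 2 * dil psi)).
  by ring.
by rewrite psi_pod_series dil_psi_pod expr1n !mul1r.
Qed.

Lemma sect2_psi2_dil_psi : sect 2 (psi ^+ 2 * dil psi) = psi * dil psi ^+ 2.
Proof.
rewrite mulrC sect_dilM //.
have -> : psi ^+ 2 = dil (A ^+ 2) + X * dil (A * dil psi *+ 2) + X ^+ 2 * dil (dil psi ^+ 2).
  by rewrite {1}[psi]psi_dissection !(rmorphMn, rmorphM, rmorphXn) /=; ring.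
by have [_ _ ->] := sect_dissection (A ^+ 2) (A * dil psi *+ 2) (dil psi ^+ 2).
Qed.

Lemma sect1_psi_dil_psi2 : sect 1 (psi * dil psi ^+ 2) = psi ^+ 2 * dil psi.
Proof. by rewrite mulrC -rmorphXn sect_dilM // sect1_psi. Qed.

Lemma sect2_psi_dil_psi2 : sect 2 (psi * dil psi ^+ 2) = 0.
Proof. by rewrite mulrC -rmorphXn sect_dilM // sect2_psi mulr0. Qed.

Lemma psi2_dil_psi_9n5 n : (psi ^+ 2 * dil psi) (9 * n + 5)%N = (psi ^+ 2 * dil psi) n.
Proof.
rewrite -[in RHS]sect1_psi_dil_psi2 -sect2_psi2_dil_psi /sect.
by congr (_ _); lia.
Qed.

Lemma psi2_dil_psi_9n8 n : (psi ^+ 2 * dil psi) (9 * n + 8)%N = 0.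
Proof.
rewrite -(series0E _ n) -sect2_psi_dil_psi2 -sect2_psi2_dil_psi /sect.
by congr (_ _); lia.
Qed.

Lemma podm3_9n6 n :
  (psi ^+ 2 * dil psi) n = (-1) ^+ (9 * n + 6) * (podm3 (9 * n + 6))%:R.
Proof.
rewrite -pod_series_cube -sect2_sect0_pod_cube /sect.
by congr (_ _); lia.
Qed.

Definition offset a := iter a (fun m => 9 * m + 5)%N 8.

(** Replacing m by 9m + 5 multiplies 8m + 5 by 9, and the start m = 8 gives 69. *)
Lemma offsetE a : (8 * offset a + 5 = 69 * 9 ^ a)%N.
Proof. by elim: a => // a IH; rewrite /offset iterS -/(offset a) expnS; lia. Qed.

(** The vanishing B(9n + 8) = 0 is carried upwards by B(9m + 5) = B(m), one factor 9 at a time. *)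
Lemma psi2_dil_psi_vanish a n : (psi ^+ 2 * dil psi) (9 ^ a.+1 * n + offset a)%N = 0.
Proof.
elim: a => [|a IH]; first exact: psi2_dil_psi_9n8.
rewrite -[RHS]IH -[RHS]psi2_dil_psi_9n5 /offset iterS -/(offset a) expnS.
by congr (_ _); lia.
Qed.

End Mod9.

Theorem theorem2p3 (alpha n : nat) (halpha : 1 <= alpha) :
  podm3 (3 ^ (2 * alpha + 2) * n + (23 * 3 ^ (2 * alpha + 1) + 3) %/ 8)
    = 0 %[mod 9].
Proof.
case: alpha halpha => // a _.
have -> : 3 ^ (2 * a.+1 + 2) = 9 * 9 ^ a.+1.
  by rewrite -expnS -(expnM 3 2); congr (3 ^ _); lia.
(* By [offsetE], 8 (9 [offset a] + 6) = 9 (69 * 9^a - 5) + 48 = 23 * 27 * 9^a + 3, so the division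
   is exact. *)
have -> : (23 * 3 ^ (2 * a.+1 + 1) + 3) %/ 8 = 9 * offset a + 6.
  have -> : 3 ^ (2 * a.+1 + 1) = 27 * 9 ^ a.
    by rewrite -[27]/(3 ^ 3) -(expnM 3 2) -expnD; congr (3 ^ _); lia.
  by have := offsetE a; lia.
have -> : 9 * 9 ^ a.+1 * n + (9 * offset a + 6) = 9 * (9 ^ a.+1 * n + offset a) + 6.
  by lia.
have /eqP := psi2_dil_psi_vanish a n.
(* The sign is a regular element, so [podm3] itself vanishes in ['Z_9]. *)
rewrite podm3_9n6 mulrI_eq0; last exact: lreg_sign.
by move=> /eqP /(congr1 val) /=; rewrite val_Zp_nat.
Qed.
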